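(* If $n\ge1$ and $B\subset\mathbb{C}^n$ is a balanced domain, then $h_{\hat B}=h_B^{(2n-1)}$ on $\mathbb{C}^n$.
   Context: A domain (nonempty connected open set) $B\subset\mathbb{C}^n$ is balanced if $\lambda X\in B$ for every $\lambda\in\mathbb{C}$ with $|\lambda|\le1$ and every $X\in B$. $\hat B$ denotes the convex hull of $B$. For a domain $S\subset\mathbb{C}^n$ starlike with respect to the origin (in particular for $S=B$ or $S=\hat B$), the Minkowski function is $h_S(X)=\inf\{t>0:\ X/t\in S\}$, $X\in\mathbb{C}^n$, and for $m\in\mathbb{N}$, $m\ge1$, $$h_S^{(m)}(X)=\inf\Big\{\sum_{j=1}^mh_S(X_j):\ X_1,\dots,X_m\in\mathbb{C}^n,\ \sum_{j=1}^mX_j=X\Big\}.$$ *)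

(* Defs.v *)
From mathcomp Require Export all_boot all_order all_algebra.
From mathcomp Require Export complex.
From mathcomp Require Export all_classical all_reals all_analysis.

Set Implicit Arguments.
Unset Strict Implicit.
Unset Printing Implicit Defensive.

Import Order.TTheory GRing.Theory Num.Theory numFieldNormedType.Exports.

Local Open Scope classical_set_scope.
Local Open Scope complex_scope.
Local Open Scope ring_scope.

(* The complex numbers are R[i] for R : realType, and C^n is 'rV[R[i]^o]_n: the
   alias R[i]^o of R[i] is the one that carries the norm topology. *)

Definition domain (T : topologicalType) (B : set T) : Prop :=
  [/\ B !=set0, open B & connected B].

Definition balanced (K : numDomainType) (V : lmodType K) (B : set V) : Prop :=
  forall (l : K) (X : V), `|l| <= 1 -> B X -> B (l *: X).

(* For K = R[i], the weights t : {i01 K} of convex_set satisfy 0 <= t <= 1 in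
   the partial order of R[i], in which comparable elements have the same
   imaginary part; t is thus real, and this is the usual (real) convexity. *)
Definition convex_hull (K : numDomainType) (V : lmodType K) (B : set V) :
  set V := smallest (@convex_set K V) B.

Section minkowski_function.
Variables (R : realType) (V : lmodType R[i]).
Implicit Types (S : set V) (X : V).

(* inf is the infimum in R, with inf set0 = 0 by convention; the sets below are
   nonempty as soon as S is absorbing (e.g. a neighborhood of 0) and 0 < m. *)

Definition minkowski_fun S X : R :=
  inf [set t : R | 0 < t /\ S (t%:C^-1 *: X)].

Definition minkowski_fun_sum S (m : nat) X : R :=
  inf [set \sum_(j < m) minkowski_fun S (Y j) |
        Y in [set Y : 'I_m -> V | \sum_(j < m) Y j = X]].

End minkowski_function.

(* Main.v *)
Require Import Defs.
Import Order.TTheory GRing.Theory Num.Theory numFieldNormedType.Exports.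
From mathcomp Require Import ring lra.
Local Open Scope classical_set_scope.
Local Open Scope complex_scope.
Local Open Scope ring_scope.

Set Implicit Arguments.
Unset Strict Implicit.
Unset Printing Implicit Defensive.
Import Normc.

(** A point [X / t] of the convex hull of [B] gives a representation
    [X = \sum_j z_j Y_j] with [Y_j] in [B], complex coefficients [z_j] and
    [\sum_j |z_j| <= t]; since [B] is balanced, the Minkowski function of [B]
    at [z_j Y_j] is at most [|z_j|].  Conversely, if [X_j / t_j] is in [B] for
    all [j], then [\sum_j X_j] divided by [\sum_j t_j] is a convex combination
    of these points ([convex_set_sum]).  Hence the Minkowski function of the
    hull is the infimum of the sums over decompositions with any number of
    terms, and everything rests on bringing that number down to [2n - 1] without
    raising [\sum_j |z_j|]
    ([abs_comb_caratheodory]).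

    The usual Caratheodory argument only gives [2n], the real dimension of
    [C^n]; the last term is saved by rotating the coefficients.  Fix the [Y_j]
    and choose [z] minimizing [\sum_j |z_j|] among the representations of [X]
    ([exists_l1_min], by compactness).  If some [z_j] is zero, a term can be
    dropped.  Otherwise put [w_j = z_j Y_j] and perturb [z_j] to
    [(1 + t e_j) z_j], where [\sum_j e_j w_j = 0]: minimality forces
    [\sum_j e_j |z_j| = 0] ([l1_minimal_stationary]).  Every complex linear
    relation between the [w_j] is thus a relation between the numbers [|z_j|],
    so there is a complex linear functional [l] with [l (w_j) = |z_j|]
    ([l1_minimal_functional]).  These values are real and positive, so [l] is
    nonzero and all the [w_j] lie in the kernel of its imaginary part, a real
    hyperplane of dimension [2n - 1].  As soon as there are [2n] terms, they
    satisfy a nontrivial real relation [\sum_j r_j w_j = 0]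
    ([real_dependence]), and [\sum_j r_j |z_j| = 0] follows.  Moving [z] along
    that relation, as far as the factors [1 - s r_j] stay nonnegative, keeps
    [\sum_j |z_j|] constant until a coefficient vanishes
    ([l1_vanishing_coord]). *)

Local Notation Re := (@complex.Re _).
Local Notation Im := (@complex.Im _).

(** * Minimizing the sum of the moduli of the coefficients *)

Lemma continuous_sum_ord (T : topologicalType) (R : realType) (m : nat)
    (f : 'I_m -> T -> R) :
  (forall i, continuous (f i)) -> continuous (fun x => \sum_i f i x).
Proof.
move=> fc x; apply: cvg_big => //.
  exact: add_continuous.
by move=> i _; exact: fc.
Qed.

(** The bound on the coordinates makes the sublevel sets of [f] bounded, so the
    minimum over the affine subspace is a minimum over a compact set. *)
Lemma exists_min_coercive (R : realType) (m q : nat) (A : 'M[R]_(m, q))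
    (f : 'rV[R]_m -> R) (u0 : 'rV[R]_m) :
  continuous f -> (forall (u : 'rV_m) i, `|u 0 i| <= f u) ->
  exists2 u, u *m A = u0 *m A & forall v, v *m A = u0 *m A -> f u <= f v.
Proof.
move=> fc fge; pose K := [set u | f u <= f u0 /\ u *m A = u0 *m A].
have Ku0 : K u0 by [].
have mulc k : continuous (fun u : 'rV[R]_m => (u *m A) 0 k).
  rewrite (_ : (fun u => _) = fun u : 'rV_m => \sum_j u 0 j * A j k);
    last by apply/funext => u; rewrite mxE.
  apply: continuous_sum_ord => j u.
  by apply: continuousM; [exact: coord_continuous|exact: cst_continuous].
have Kclosed : closed K.
  rewrite (_ : K = (f @^-1` [set x | x <= f u0]) `&`
      \bigcap_(k in [set: 'I_q])
        ((fun u : 'rV[R]_m => (u *m A) 0 k) @^-1` [set x | x = (u0 *m A) 0 k])).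
    apply: closedI; first by apply: preimage_closed => // *; exact: fc.
    apply: closed_bigI => k _; apply: preimage_closed; last exact: closed_eq.
    by move=> ? _; exact: mulc.
  apply/seteqP; split => u /=.
    by move=> [fu Au]; split => // k _ /=; rewrite Au.
  by move=> [fu Au]; split => //; apply/rowP => k; exact: (Au k I).
have Kbounded : bounded_set K.
  exists `|f u0|; split; first exact: num_real.
  move=> M fM u [fu _]; apply: (@le_trans _ _ `|f u0|); last exact: ltW.
  rewrite [leLHS]/Num.norm /= mx_normrE.
  apply/bigmax_leP; split => // -[i j] _ /=.
  rewrite (ord1 i); exact: le_trans (fge _ _) (le_trans fu (ler_norm _)).
have [|||u] := @EVT_min_rV _ _ f K.
- by exists u0.
- exact: bounded_closed_compact.
- exact: continuous_subspaceT.
rewrite inE => -[fu uA] umin; exists u => // v vA.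
case: (leP (f v) (f u0)) => [fv|/ltW]; last exact: le_trans.
by apply: umin; rewrite inE.
Qed.

Lemma Re_mulmx (R : realType) (m n p : nat) (A : 'M[R[i]]_(m, n))
    (B : 'M[R[i]]_(n, p)) :
  map_mx Re (A *m B) = map_mx Re A *m map_mx Re B - map_mx Im A *m map_mx Im B.
Proof.
apply/matrixP => i k; rewrite !mxE raddf_sum -sumrB /=.
by apply: eq_bigr => j _; rewrite !mxE; case: (A i j) (B j k) => [a b] [c d].
Qed.

Lemma Im_mulmx (R : realType) (m n p : nat) (A : 'M[R[i]]_(m, n))
    (B : 'M[R[i]]_(n, p)) :
  map_mx Im (A *m B) = map_mx Re A *m map_mx Im B + map_mx Im A *m map_mx Re B.
Proof.
apply/matrixP => i k; rewrite !mxE raddf_sum -big_split /=.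
by apply: eq_bigr => j _; rewrite !mxE; case: (A i j) (B j k) => [a b] [c d].
Qed.

(** The identification of complex matrices with real ones of double width; it
    carries row vectors of [C^n] to vectors of [R^(2n)]. *)
Definition re_im (R : realType) (m n : nat) (A : 'M[R[i]]_(m, n)) :
    'M[R]_(m, n + n) := row_mx (map_mx Re A) (map_mx Im A).

Lemma re_im_inj (R : realType) (m n : nat) : injective (@re_im R m n).
Proof.
move=> A B /eq_row_mx[/matrixP reAB /matrixP imAB]; apply/matrixP => i j.
have := imAB i j; have := reAB i j; rewrite !mxE.
by case: (A i j) (B i j) => [a b] [c d] /= -> ->.
Qed.

Lemma normc_sqrt (R : realType) (z : R[i]) :
  normc z = Num.sqrt (Re z ^+ 2 + Im z ^+ 2).
Proof. by case: z. Qed.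

Lemma normc_ge0 (R : realType) (z : R[i]) : 0 <= normc z.
Proof. by rewrite normc_sqrt sqrtr_ge0. Qed.

Lemma normcR (R : realType) (t : R) : 0 <= t -> normc t%:C = t.
Proof.
by move=> t0; rewrite normc_sqrt /= expr0n addr0 sqrtr_sqr ger0_norm.
Qed.

Definition l1_minimal (R : realType) (m n : nat) (M : 'M[R[i]]_(m, n))
    (z : 'rV[R[i]]_m) :=
  forall v, v *m M = z *m M -> \sum_j normc (z 0 j) <= \sum_j normc (v 0 j).

Lemma exists_l1_min (R : realType) (m n : nat) (M : 'M[R[i]]_(m, n))
    (z0 : 'rV[R[i]]_m) :
  exists2 z, z *m M = z0 *m M & l1_minimal M z.
Proof.
(* Right multiplication by [A] is right multiplication by [M], seen through
   [re_im]. *)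
pose A := block_mx (map_mx Re M) (map_mx Im M) (- map_mx Im M) (map_mx Re M).
have re_imM (z : 'rV[R[i]]_m) : re_im z *m A = re_im (z *m M).
  by rewrite mul_row_block !mulmxN -Re_mulmx -Im_mulmx.
pose toC (u : 'rV[R]_(m + m)) : 'rV[R[i]]_m :=
  \row_j (u 0 (lshift m j) +i* u 0 (rshift m j)).
have toCK u : re_im (toC u) = u.
  by rewrite -[RHS]hsubmxK; congr row_mx; apply/rowP => j; rewrite !mxE.
pose f (u : 'rV[R]_(m + m)) := \sum_j normc (toC u 0 j).
have fE z : f (re_im z) = \sum_j normc (z 0 j).
  by rewrite /f (_ : toC (re_im z) = z) //; apply: re_im_inj; rewrite toCK.
have fc : continuous f.
  apply: continuous_sum_ord => j u.
  rewrite (_ : (fun u => normc _) = Num.sqrt \o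
    (fun u : 'rV[R]_(m + m) =>
       u 0 (lshift m j) ^+ 2 + u 0 (rshift m j) ^+ 2)); last first.
    by apply/funext => v /=; rewrite normc_sqrt !mxE.
  apply: continuous_comp; last exact: sqrt_continuous.
  by apply: continuousD; apply: continuousM; exact: coord_continuous.
have fge (u : 'rV[R]_(m + m)) i : `|u 0 i| <= f u.
  rewrite /f; have normu j : `|u 0 (lshift m j)| <= normc (toC u 0 j) /\
      `|u 0 (rshift m j)| <= normc (toC u 0 j).
    rewrite !normc_sqrt !mxE /= -!sqrtr_sqr !ler_wsqrtr //.
    - by rewrite lerDr sqr_ge0.
    - by rewrite lerDl sqr_ge0.
  have [j ->|j ->] := split_ordP i; rewrite (bigD1 j) //= -[leLHS]addr0 lerD //.
  - by case: (normu j).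
  - by apply: sumr_ge0 => k _; exact: normc_ge0.
  - by case: (normu j).
  - by apply: sumr_ge0 => k _; exact: normc_ge0.
have [u uA umin] := exists_min_coercive A (re_im z0) fc fge.
have uM : toC u *m M = z0 *m M by apply: re_im_inj; rewrite -!re_imM toCK.
exists (toC u) => // v vM; rewrite -!fE toCK; apply: umin.
by rewrite !re_imM vM uM.
Qed.

(** * First-order conditions at a minimum *)

(** By the inequality [sqrt s <= (s + 1) / 2]. This one-sided expansion of the
    modulus, exact to first order at [t = 0], replaces its derivative. *)
Lemma normc_add1_le (R : realType) (e : R[i]) (t : R) :
  normc (1 + t%:C * e) <=
    1 + t * Re e + t ^+ 2 * ((Re e ^+ 2 + Im e ^+ 2) / 2).
Proof.
rewrite normc_sqrt; case: e => a b /=.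
set s := (X in Num.sqrt X).
have s0 : 0 <= s by rewrite addr_ge0 ?sqr_ge0.
have := sqr_ge0 (Num.sqrt s - 1); rewrite sqrrB1 sqr_sqrtr //.
by move: (Num.sqrt s) => q; rewrite /s; lra.
Qed.

Lemma linear_coef_eq0 (R : realType) (p q : R) :
  0 <= q -> (forall t, 0 <= t * p + t ^+ 2 * q) -> p = 0.
Proof.
(* The minimum [- p / (2 q)] of the quadratic would need [q != 0]. *)
move=> q0 /(_ (- p / (1 + q))).
have q1 : 1 + q != 0 by rewrite gt_eqF // ltr_pwDl.
rewrite (_ : _ + _ = - (p / (1 + q)) ^+ 2); last by field.
rewrite oppr_ge0 => pq; apply/eqP.
have /eqP : (p / (1 + q)) ^+ 2 = 0 by apply/eqP; rewrite eq_le pq sqr_ge0.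
by rewrite sqrf_eq0 mulf_eq0 invr_eq0 (negbTE q1) orbF.
Qed.

(** Replacing [z_j] by [(1 + t e_j) z_j] with [t] real changes the sum of the
    moduli by [t * \sum_j Re (e_j) |z_j|] up to second order, whence the real
    part of the claim; the imaginary part is the real part for ['i * e]. *)
Lemma l1_minimal_stationary (R : realType) (m n : nat) (M : 'M[R[i]]_(m, n))
    (z e : 'rV[R[i]]_m) :
  l1_minimal M z -> e *m (diag_mx z *m M) = 0 ->
  \sum_j e 0 j * (normc (z 0 j))%:C = 0.
Proof.
move=> zmin.
have Re0 (d : 'rV[R[i]]_m) : d *m (diag_mx z *m M) = 0 ->
    \sum_j Re (d 0 j) * normc (z 0 j) = 0.
  move=> dM.
  pose q := \sum_j (Re (d 0 j) ^+ 2 + Im (d 0 j) ^+ 2) / 2 * normc (z 0 j).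
  apply: (@linear_coef_eq0 _ _ q).
    apply: sumr_ge0 => j _; rewrite mulr_ge0 ?normc_ge0 //.
    by rewrite divr_ge0 ?ler0n // addr_ge0 ?sqr_ge0.
  move=> t; have := zmin (z + t%:C *: (d *m diag_mx z)).
  rewrite mulmxDl -scalemxAl -mulmxA dM scaler0 addr0 => /(_ erefl).
  rewrite !mulr_sumr -big_split -subr_ge0 -sumrB => /le_trans; apply.
  apply: ler_sum => j _ /=; rewrite mul_mx_diag !mxE.
  rewrite mulrA -{1}[z 0 j]mul1r -mulrDl normcM.
  have := ler_wpM2r (normc_ge0 (z 0 j)) (normc_add1_le (d 0 j) t).
  by lra.
move=> eM.
have eiM : ('i%C *: e) *m (diag_mx z *m M) = 0.
  by rewrite -scalemxAl eM scaler0.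
apply/eqP; rewrite eq_complex !raddf_sum /=; apply/andP; split; apply/eqP.
  rewrite -[RHS](Re0 e eM); apply: eq_bigr => j _.
  by case: (e 0 j) => a b /=; rewrite mulr0 subr0.
rewrite -[RHS]oppr0 -[X in - X](Re0 _ eiM) -sumrN; apply: eq_bigr => j _.
by rewrite mxE; case: (e 0 j) => a b /=; lra.
Qed.

(** By stationarity, the vector of moduli is orthogonal to all the relations
    between the rows of [diag_mx z *m M], hence lies in the column space. *)
Lemma l1_minimal_functional (R : realType) (m n : nat) (M : 'M[R[i]]_(m, n))
    (z : 'rV[R[i]]_m) :
  l1_minimal M z ->
  exists l : 'cV[R[i]]_n,
    diag_mx z *m M *m l = \col_j (normc (z 0 j))%:C.
Proof.
move=> zmin; set W := diag_mx z *m M; pose b := \row_j (normc (z 0 j))%:C.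
have /submxP[l bE] : (b <= W^T)%MS.
  rewrite submxE; apply/eqP/rowP => k; rewrite !mxE.
  have kW : row k (cokermx W^T)^T *m W = 0.
    by rewrite -row_mul -[W]trmxK -trmx_mul trmxK mulmx_coker trmx0 row0.
  rewrite -[RHS](l1_minimal_stationary zmin kW).
  by apply: eq_bigr => j _; rewrite !mxE mulrC.
exists l^T; rewrite -[W]trmxK -trmx_mul -bE.
by apply/colP => j; rewrite !mxE.
Qed.

(** The rows of [W] lie in the kernel of the imaginary part of [l], which is a
    real hyperplane of [C^n] because the real part of [l] is nonzero on them. *)
Lemma real_dependence (R : realType) (m n : nat) (W : 'M[R[i]]_(m, n))
    (l : 'cV[R[i]]_n) :
  (0 < m)%N -> (2 * n <= m)%N -> (forall j, 0 < (W *m l) j 0) ->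
  exists2 r : 'rV[R]_m, r != 0 & map_mx (real_complex R) r *m W = 0.
Proof.
move=> m_gt0 le_nm Wl_gt0.
have Wl_real : map_mx Im (W *m l) = 0.
  apply/colP => j; rewrite [LHS]mxE [RHS]mxE.
  exact/ger0_Im/ltW/Wl_gt0.
(* As a column of length [2n], [v] is the real linear form [Im l]. *)
pose v := col_mx (map_mx Im l) (map_mx Re l).
have Uv : re_im W *m v = 0 by rewrite mul_row_col -Im_mulmx.
have v_neq0 : v != 0.
  apply/eqP; rewrite -[0]vsubmxK => /eq_col_mx[Iml Rel].
  have : map_mx Re (W *m l) = 0.
    by rewrite Re_mulmx Iml Rel !(linear0, mulmx0, oppr0, addr0).
  move=> /matrixP/(_ (Ordinal m_gt0) 0).
  have := Wl_gt0 (Ordinal m_gt0); rewrite !mxE ltcE => /andP[_ /[swap] ->].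
  by rewrite ltxx.
have Unfree : ~~ row_free (re_im W).
  apply/negP => /eqP rankU.
  have : row_free (re_im W)^T.
    rewrite /row_free mxrank_tr eqn_leq rank_leq_col /= rankU.
    by rewrite addnn -mul2n.
  move/mulmx_free_eq0 => /(_ _ v^T).
  by rewrite -trmx_mul Uv trmx0 eqxx -trmx0 (inj_eq trmx_inj) (negPf v_neq0).
move: Unfree; rewrite -kermx_eq0 => /rowV0Pn[r /sub_kermxP rU r_neq0].
exists r => //; apply: re_im_inj.
have Rer : map_mx Re (map_mx (real_complex R) r) = r.
  by apply/rowP => j; rewrite !mxE.
have Imr : map_mx Im (map_mx (real_complex R) r) = 0.
  by apply/rowP => j; rewrite !mxE.
rewrite /re_im Re_mulmx Im_mulmx Rer Imr !mul0mx subr0 addr0 -mul_mx_row rU.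
by rewrite -[LHS]hsubmxK !linear0; congr row_mx; apply/rowP => j; rewrite !mxE.
Qed.

(** A minimizer without a zero coordinate can be moved, at constant cost, to
    one that has a zero coordinate. *)
Lemma l1_vanishing_coord (R : realType) (m n : nat) (M : 'M[R[i]]_(m, n))
    (z0 : 'rV[R[i]]_m) :
  (0 < m)%N -> (2 * n <= m)%N ->
  exists z, [/\ z *m M = z0 *m M,
    \sum_j normc (z 0 j) <= \sum_j normc (z0 0 j) & exists j, z 0 j = 0].
Proof.
move=> m_gt0 le_nm; have [z zM zmin] := exists_l1_min M z0.
have zle := zmin z0 (esym zM).
have [/existsP[j /eqP zj0]|/existsPn z_neq0] := boolP [exists j, z 0 j == 0].
  by exists z; split => //; exists j.
have normz_gt0 j : 0 < normc (z 0 j).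
  rewrite lt_def normc_ge0 andbT.
  by apply: contra (z_neq0 j) => /eqP/eq0_normc ->.
have [l Wl] := l1_minimal_functional zmin.
have [|r r_neq0 rW] := @real_dependence _ _ _ (diag_mx z *m M) l m_gt0 le_nm.
  by move=> j; rewrite Wl mxE ltcR.
have zstat : \sum_j r 0 j * normc (z 0 j) = 0.
  apply: (@complexI R); rewrite -[RHS](l1_minimal_stationary zmin rW) raddf_sum.
  by apply: eq_bigr => j _; rewrite mxE -rmorphM.
(* Since [|r_j|] is largest at [j0], the factors [s j] are all nonnegative and
   the sum of the moduli stays linear along the move that kills [z_j0]. *)
have [j0 _ r_max] :=
  @arg_maxP _ _ _ (Ordinal m_gt0) predT (fun j => `|r 0 j|) isT.
have rj0 : r 0 j0 != 0.
  apply: contra r_neq0 => /eqP rj0; apply/eqP/rowP => j; rewrite mxE.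
  apply/normr0_eq0/le_anti; rewrite normr_ge0 andbT.
  by rewrite (le_trans (r_max j isT)) // rj0 normr0.
pose s j := 1 - r 0 j / r 0 j0.
have s_ge0 j : 0 <= s j.
  rewrite subr_ge0 (le_trans (ler_norm _)) // normrM normfV.
  by rewrite ler_pdivrMr ?normr_gt0 // mul1r; exact: r_max.
exists (z - (r 0 j0)^-1%:C *: (map_mx (real_complex R) r *m diag_mx z)).
have zE j : (z - (r 0 j0)^-1%:C *: (map_mx (real_complex R) r *m diag_mx z)) 0 j
    = (s j)%:C * z 0 j.
  rewrite mul_mx_diag !mxE /s rmorphB rmorphM /= rmorph1; ring.
split.
- by rewrite mulmxBl -scalemxAl -mulmxA rW scaler0 subr0.
- apply: le_trans zle; rewrite le_eqVlt; apply/orP; left; apply/eqP.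
  transitivity (\sum_j (normc (z 0 j) - (r 0 j0)^-1 * (r 0 j * normc (z 0 j)))).
    apply: eq_bigr => j _; rewrite zE normcM normcR // /s; ring.
  by rewrite sumrB -mulr_sumr zstat mulr0 subr0.
- by exists j0; rewrite zE /s divff // subrr mul0r.
Qed.

(** * Absolutely convex combinations *)

(** Complex coefficients let the phases vary in the minimization, and the points
    of [B] are the rows of a matrix so that the combination is a product. *)
Definition abs_comb (R : realType) (n : nat) (B : set 'rV[R[i]^o]_n)
    (m : nat) (c : R) (X : 'rV[R[i]^o]_n) :=
  exists (z : 'rV[R[i]]_m) (Y : 'M[R[i]]_(m, n)),
    [/\ forall j, B (row j Y), X = z *m Y & \sum_j normc (z 0 j) <= c].

Lemma abs_comb_pad (R : realType) (n : nat) (B : set 'rV[R[i]^o]_n)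
    (m p : nat) (c : R) (X : 'rV[R[i]^o]_n) :
  B 0 -> abs_comb B m c X -> abs_comb B (m + p) c X.
Proof.
move=> B0 [z [Y [BY -> zc]]]; exists (row_mx z 0), (col_mx Y 0); split.
- move=> j; have [k ->|k ->] := split_ordP j; first by rewrite rowKu.
  by rewrite rowKd row0.
- by rewrite mul_row_col mul0mx addr0.
- rewrite big_split_ord /= [X in _ + X]big1 ?addr0.
    by apply: le_trans zc; apply: ler_sum => j _; rewrite row_mxEl.
  by move=> j _; rewrite row_mxEr mxE normc0.
Qed.

Lemma abs_comb_drop (R : realType) (n : nat) (B : set 'rV[R[i]^o]_n)
    (m : nat) (c : R) (X : 'rV[R[i]^o]_n) :
  (2 * n <= m.+1)%N -> abs_comb B m.+1 c X -> abs_comb B m c X.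
Proof.
move=> le_nm [z0 [Y [BY -> zc]]].
have [z [<- zle [j zj0]]] := l1_vanishing_coord Y z0 (ltn0Sn m) le_nm.
exists (col' j z), (row' j Y); split.
- move=> k; rewrite (_ : row k _ = row (lift j k) Y) //.
  by apply/rowP => i; rewrite !mxE.
- apply/rowP => i; rewrite !mxE (bigD1_ord j) //= zj0 mul0r add0r.
  by apply: eq_bigr => k _; rewrite !mxE.
- apply: le_trans zc; apply: le_trans zle.
  rewrite [leRHS](bigD1_ord j) //= zj0 normc0 add0r.
  by apply: ler_sum => k _; rewrite mxE.
Qed.

(** Padding with zero terms first makes the descent start at or above
    [2 * n - 1], whatever [m] is. *)
Lemma abs_comb_caratheodory (R : realType) (n : nat) (B : set 'rV[R[i]^o]_n)
    (m : nat) (c : R) (X : 'rV[R[i]^o]_n) :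
  B 0 -> abs_comb B m c X -> abs_comb B (2 * n - 1) c X.
Proof.
move=> B0 /(abs_comb_pad (2 * n - 1) B0); elim: m => [|m IHm] //.
rewrite addSn => BX; apply: IHm; apply: abs_comb_drop BX.
by rewrite -addnS subn1; case: (2 * n)%N => // k; exact: leq_addl.
Qed.

(** The combinations of total modulus at most [1], with any number of terms,
    form a convex set: concatenate the two combinations. *)
Lemma convex_hull_abs_comb (R : realType) (n : nat) (B : set 'rV[R[i]^o]_n)
    (X : 'rV[R[i]^o]_n) :
  convex_hull B X -> exists m, abs_comb B m 1 X.
Proof.
move=> hX; apply: (hX [set X | exists m, abs_comb B m 1 X]); split.
  move=> x y t; rewrite !inE => -[m1 [z1 [Y1 [BY1 -> z1c]]]].
  move=> [m2 [z2 [Y2 [BY2 -> z2c]]]].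
  (* Weights between [0] and [1] are real in the partial order of [R[i]]. *)
  have [s [s0 s1 tE]] : exists s : R, [/\ 0 <= s, s <= 1 & t%:num = s%:C].
    have t0 : (0 : R[i]) <= t%:num by [].
    have t1 : t%:num <= (1 : R[i]) by [].
    exists (Re t%:num); move: t0 t1; rewrite !lecE /= => /andP[/eqP imt ->].
    by move=> /andP[_ ->]; split => //; case: (t%:num) imt => a b /= ->.
  exists (m1 + m2)%N.
  exists (row_mx (s%:C *: z1) ((1 - s)%:C *: z2)), (col_mx Y1 Y2); split.
  - by move=> j; have [k ->|k ->] := split_ordP j; rewrite ?rowKu ?rowKd.
  - rewrite mul_row_col -!scalemxAl /conv /= /unstable.onem tE.
    by rewrite rmorphB rmorph1.
  - rewrite big_split_ord /=; apply: (@le_trans _ _ (s * 1 + (1 - s) * 1)).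
      rewrite lerD //.
        apply: le_trans (ler_wpM2l s0 z1c); rewrite mulr_sumr.
        by apply: ler_sum => j _; rewrite row_mxEl mxE normcM normcR.
      apply: (@le_trans _ _ ((1 - s) * \sum_j normc (z2 0 j))).
        rewrite mulr_sumr; apply: ler_sum => j _.
        by rewrite row_mxEr mxE normcM normcR // subr_ge0.
      by rewrite ler_wpM2l // subr_ge0.
    by rewrite !mulr1 addrC subrK.
move=> Y BY; exists 1, (const_mx 1), Y; split.
- move=> j; rewrite (_ : row j Y = Y) //.
  by apply/rowP => k; rewrite mxE (ord1 j).
- by apply/rowP => k; rewrite mxE big_ord1 mxE mul1r.
- by rewrite big_ord1 mxE normc1.
Qed.

Lemma convex_hull_convex (K : numDomainType) (V : lmodType K) (B : set V) :
  convex_set (convex_hull B).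
Proof.
move=> x y t; rewrite !inE => hx hy C CB; apply/set_mem.
by apply: (CB.1); apply/mem_set; [exact: (hx C CB)|exact: (hy C CB)].
Qed.

Lemma convex_set_sum (R : realType) (n m : nat) (C : set 'rV[R[i]^o]_n)
    (t : 'I_m.+1 -> R) (Y : 'I_m.+1 -> 'rV[R[i]^o]_n) :
  convex_set C -> (forall j, 0 < t j) -> (forall j, C (Y j)) ->
  C ((\sum_j t j)%:C^-1 *: \sum_j (t j)%:C *: Y j).
Proof.
move=> Cconv; elim: m => [|m IHm] in t Y * => t_gt0 CY.
  rewrite !big_ord1 scalerA mulVf ?scale1r //.
  by rewrite (inj_eq (@complexI R) _ 0) gt_eqF.
rewrite big_ord_recl [X in _ *: X]big_ord_recl /=.
set T := \sum_j _; set S := \sum_j _.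
have T_gt0 : 0 < T.
  by rewrite /T big_ord_recl ltr_pwDl // sumr_ge0 // => j _; exact: ltW.
have tT_gt0 : 0 < t ord0 + T by rewrite addr_gt0.
have CS : C (T%:C^-1 *: S) by exact: IHm.
pose p : R[i] := (t ord0 / (t ord0 + T))%:C.
have p01 : 0 <= p <= 1.
  apply/andP; split.
    by rewrite /p ler0c divr_ge0 // ltW.
  by rewrite /p -[1]/(1%:C) lecR ler_pdivrMr // mul1r lerDl ltW.
have [p0 p1] := andP p01.
have := Cconv _ _ (Itv01 p0 p1) (mem_set (CY ord0)) (mem_set CS).
rewrite inE /conv /= /unstable.onem.
rewrite (_ : _ + _ = (t ord0 + T)%:C^-1 *: ((t ord0)%:C *: Y ord0 + S)) //.
rewrite scalerDr !scalerA /p -!fmorphV -(rmorph1 (real_complex R)).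
rewrite -rmorphB -!rmorphM; congr (_%:C *: _ + _%:C *: _).
  by rewrite mulrC.
by field; rewrite !gt_eqF.
Qed.

(** * Minkowski functions *)

Section Minkowski.
Variables (R : realType) (n : nat).
Implicit Types (S B : set 'rV[R[i]^o]_n) (X Y : 'rV[R[i]^o]_n).

Let has_inf_minkowski S X :
  (exists2 t : R, 0 < t & S (t%:C^-1 *: X)) ->
  has_inf [set t : R | 0 < t /\ S (t%:C^-1 *: X)].
Proof.
by move=> [t t0 St]; split; [exists t | exists 0 => s [/ltW]].
Qed.

Lemma minkowski_fun_le S X (t : R) :
  0 < t -> S (t%:C^-1 *: X) -> minkowski_fun S X <= t.
Proof. by move=> t0 St; apply: ge_inf => //; exists 0 => s [/ltW]. Qed.

Lemma minkowski_fun_ge0 S X : 0 <= minkowski_fun S X.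
Proof.
rewrite /minkowski_fun; set E := [set _ | _].
have [->|/set0P E0] := eqVneq E set0; first by rewrite inf0.
by apply: lb_le_inf => // t [/ltW].
Qed.

Lemma minkowski_fun_adherent S X (eps : R) :
  (exists2 t : R, 0 < t & S (t%:C^-1 *: X)) -> 0 < eps ->
  exists t : R, [/\ 0 < t, S (t%:C^-1 *: X) & t < minkowski_fun S X + eps].
Proof.
move=> /has_inf_minkowski Sinf eps0.
by have [t [t0 St] tlt] := inf_adherent eps0 Sinf; exists t.
Qed.

Lemma open_absorbing B X : open B -> B 0 ->
  exists2 t : R, 0 < t & B (t%:C^-1 *: X).
Proof.
move=> Bopen B0.
have : \forall k \near (0 : R[i]^o), B (k *: X).
  have := @scalel_continuous _ _ X (0 : R[i]^o).
  rewrite /continuous_at scale0r; apply.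
  by apply: open_nbhs_nbhs; split.
move=> /nbhs_ballP[e /= e0 ballB].
have ReE : e = (Re e)%:C.
  by rewrite RRe_real // ger0_real // ltW.
have Ree0 : 0 < Re e by move: e0; rewrite {1}ReE ltcR.
(* Any [t > 1 / Re e] would do. *)
exists (2 / Re e); first by rewrite divr_gt0.
apply: ballB; rewrite /ball /= sub0r normrN -fmorphV.
rewrite ger0_norm ?ler0c ?invr_ge0 ?divr_ge0 // ?ltW // {2}ReE ltcR invf_div.
by rewrite ltr_pdivrMr // ltr_pMr // ltr1n.
Qed.

Lemma minkowski_fun_scale_le B Y (z : R[i]) :
  balanced B -> B Y -> minkowski_fun B (z *: Y) <= normc z.
Proof.
move=> Bbal BY; apply/ler_addgt0Pr => eps eps0.
have t0 : 0 < normc z + eps by rewrite ltr_wpDl ?normc_ge0.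
apply: minkowski_fun_le => //; rewrite scalerA; apply: Bbal => //.
rewrite -fmorphV (_ : `|_| = (normc ((normc z + eps)^-1%:C * z))%:C) //.
rewrite -[1]/(1%:C) lecR normcM normcR ?invr_ge0; last exact: ltW.
by rewrite mulrC ler_pdivrMr // mul1r lerDl ltW.
Qed.

End Minkowski.

Theorem proposition3 (R : realType) (n : nat) (n_ge1 : (1 <= n)%N)
    (B : set 'rV[R[i]^o]_n) (B_domain : domain B) (B_balanced : balanced B)
    (X : 'rV[R[i]^o]_n) :
  minkowski_fun (convex_hull B) X = minkowski_fun_sum B (2 * n - 1) X.
Proof.
have [[Y0 BY0] Bopen _] := B_domain.
have B0 : B 0.
  by rewrite -(scale0r Y0); apply: B_balanced; rewrite ?normr0 ?ler01.
have Babs Y : exists2 t : R, 0 < t & B (t%:C^-1 *: Y) by exact: open_absorbing.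
have BhB : B `<=` convex_hull B by exact: sub_smallest.
have hBabs Y : exists2 t : R, 0 < t & convex_hull B (t%:C^-1 *: Y).
  by have [t t0 Bt] := Babs Y; exists t => //; exact: BhB.
have hBconv := @convex_hull_convex _ _ B.
apply/le_anti/andP; split.
- have -> : (2 * n - 1)%N = (2 * n - 2).+1 by rewrite -subSn // leq_pmulr.
  set m := (2 * n - 2)%N; apply: lb_le_inf => [|_ [Y YX <-]].
    exists (\sum_j minkowski_fun B (if j == ord0 :> 'I_m.+1 then X else 0)).
    exists (fun j => if j == ord0 then X else 0) => //.
    by rewrite /= -big_mkcond big_pred1_eq.
  apply/ler_addgt0Pr => eps eps0.
  have eps1 : 0 < eps / m.+1%:R by rewrite divr_gt0.
  have /choice[t tP] := fun j => minkowski_fun_adherent (Babs (Y j)) eps1.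
  apply: (@le_trans _ _ (\sum_j t j)).
    apply: minkowski_fun_le.
      rewrite big_ord_recl ltr_pwDl ?sumr_ge0 //; first by case: (tP ord0).
      by move=> j _; case: (tP (lift ord0 j)) => /ltW.
    rewrite -YX (_ : \sum_j Y j = \sum_j (t j)%:C *: ((t j)%:C^-1 *: Y j)).
      apply: convex_set_sum => // j; first by case: (tP j).
      by apply: BhB; case: (tP j).
    apply: eq_bigr => j _; rewrite scalerA divff ?scale1r //.
    by rewrite (inj_eq (@complexI R) _ 0) gt_eqF //; case: (tP j).
  apply: (@le_trans _ _ (\sum_j (minkowski_fun B (Y j) + eps / m.+1%:R))).
    by apply: ler_sum => j _; case: (tP j) => _ _ /ltW.
  rewrite big_split /= lerD2l sumr_const card_ord -[(_ / _) *+ _]mulr_natr.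
  by rewrite divfK // pnatr_eq0.
- have [t0 t0_gt0 ht0] := hBabs X.
  apply: lb_le_inf => [|t [t_gt0 /convex_hull_abs_comb[k]]]; first by exists t0.
  move=> /(abs_comb_caratheodory B0) [z [Y [BY tX zt]]].
  apply: (@le_trans _ _ (\sum_j minkowski_fun B (t%:C *: (z 0 j *: row j Y)))).
    apply: ge_inf.
      exists 0 => _ [W _ <-]; apply: sumr_ge0 => j _; exact: minkowski_fun_ge0.
    exists (fun j => t%:C *: (z 0 j *: row j Y)) => //=.
    rewrite -scaler_sumr -mulmx_sum_row -tX scalerA divff ?scale1r //.
    by rewrite (inj_eq (@complexI R) _ 0) gt_eqF.
  rewrite -[leRHS]mulr1; apply: le_trans (ler_wpM2l (ltW t_gt0) zt).
  rewrite mulr_sumr; apply: ler_sum => j _; rewrite scalerA.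
  apply: le_trans (minkowski_fun_scale_le _ B_balanced (BY j)) _.
  by rewrite normcM normcR // ltW.
Qed.
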